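(* Let $\mathbf{\Psi}=(p_{ab})\in\mathbb{R}^{N\times K}$ with $N>K$ have full column rank, let $\mathcal{N}=\{1,\dots,N\}$ be its set of row indices, and let $L\ge K$ be an integer, the number of rows to be selected. Let $\mathcal{L}^*$ be an optimal solution of $$\min_{\mathcal{L}\subseteq\mathcal{N},\ |\mathcal{L}|=L}F(\mathcal{L}),\qquad F(\mathcal{L})=\mathrm{FP}(\mathbf{\Psi}(\mathcal{L})).$$ If $\mathbf{\Psi}$ is a non-orthogonal matrix and the elements of each row of $\mathbf{\Psi}$ have the same sign, then the Fast Frank-Wolfe Algorithm for Vector Signals returns a set $\mathcal{L}'$ such that $$G(\mathcal{S}')>\frac{N}{N+L}\,G(\mathcal{S}^* ),$$ where $\mathcal{S}'=\mathcal{N}\setminus\mathcal{L}'$, $\mathcal{S}^*=\mathcal{N}\setminus\mathcal{L}^*$ and $G(\mathcal{S})=F(\mathcal{N})-F(\mathcal{N}\setminus\mathcal{S})$.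
   Context: For $\mathcal{L}\subseteq\mathcal{N}$, $\mathbf{\Psi}(\mathcal{L})$ is the submatrix of $\mathbf{\Psi}$ formed by the rows indexed by $\mathcal{L}$, $\mathbf{T}(\mathcal{L})=\mathbf{\Psi}(\mathcal{L})^T\mathbf{\Psi}(\mathcal{L})$, and the frame potential is $\mathrm{FP}(\mathbf{\Psi}(\mathcal{L})):=\operatorname{tr}\{\mathbf{T}(\mathcal{L})^T\mathbf{T}(\mathcal{L})\}$. Fast Frank-Wolfe Algorithm for Vector Signals. Input: $\mathbf{\Psi}=(p_{ab})\in\mathbb{R}^{N\times K}$ and $L$. With $\boldsymbol{p}_i$ the $i$-th column of $\mathbf{\Psi}$: (1) compute $m_{ij}=\boldsymbol{p}_i^T\boldsymbol{p}_j$ for $i,j=1,\dots,K$; (2) compute $d_n=\sum_{i=1}^K\sum_{j=1}^K m_{ij}p_{ni}p_{nj}$ for $n=1,\dots,N$; (3) select the $L$ elements $d_{l_1},\dots,d_{l_L}$ with the smallest values from $\{d_1,\dots,d_N\}$; (4) return $\mathcal{L}'=\{l_1,\dots,l_L\}$.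
   Formalization: The formal statement adds L < N: for L = N both S' and S* are empty and the strict inequality would read 0 > 0. ''Same sign'' is read literally: each row is all positive, all negative or all zero. *)

(* Defs.v *)
From HB Require Import structures.
From mathcomp Require Import all_boot all_order all_algebra.
From mathcomp Require Import reals.

Set Implicit Arguments.
Unset Strict Implicit.
Unset Printing Implicit Defensive.

Import Order.TTheory GRing.Theory Num.Theory.

Local Open Scope ring_scope.

Definition select_rows (R : realType) (N K : nat) (Psi : 'M[R]_(N, K))
    (A : {set 'I_N}) : 'M[R]_(#|A|, K) :=
  rowsub (fun i : 'I_#|A| => enum_val i) Psi.

Definition gram (R : realType) (m K : nat) (M : 'M[R]_(m, K)) : 'M[R]_K :=
  M^T *m M.

Definition frame_potential (R : realType) (m K : nat) (M : 'M[R]_(m, K)) : R :=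
  \tr ((gram M)^T *m gram M).

Definition F (R : realType) (N K : nat) (Psi : 'M[R]_(N, K))
    (A : {set 'I_N}) : R :=
  frame_potential (select_rows Psi A).

Definition G (R : realType) (N K : nat) (Psi : 'M[R]_(N, K))
    (S : {set 'I_N}) : R :=
  F Psi [set: 'I_N] - F Psi (~: S).

Definition optimal_selection (R : realType) (N K : nat) (Psi : 'M[R]_(N, K))
    (L : nat) (A : {set 'I_N}) : Prop :=
  #|A| = L /\ forall B : {set 'I_N}, #|B| = L -> F Psi A <= F Psi B.

(* For a tall matrix, "orthogonal" means that the columns are orthonormal. *)
Definition orthogonal_columns (R : realType) (N K : nat)
    (Psi : 'M[R]_(N, K)) : Prop :=
  Psi^T *m Psi = 1%:M.

(* Signs are taken in {-1, 0, 1}: each row is entirely positive, entirely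
   negative, or zero; zero may not be mixed with nonzero entries. *)
Definition rows_same_sign (R : realType) (N K : nat)
    (Psi : 'M[R]_(N, K)) : Prop :=
  forall (n : 'I_N) (i j : 'I_K), Num.sg (Psi n i) = Num.sg (Psi n j).

Definition ffw_m (R : realType) (N K : nat) (Psi : 'M[R]_(N, K))
    (i j : 'I_K) : R :=
  ((col i Psi)^T *m col j Psi) 0 0.

Definition ffw_d (R : realType) (N K : nat) (Psi : 'M[R]_(N, K))
    (n : 'I_N) : R :=
  \sum_(i < K) \sum_(j < K) ffw_m Psi i j * Psi n i * Psi n j.

(* The Fast Frank-Wolfe algorithm does not specify how ties among the d_n are
   broken, so its result is a relation: [A] is a possible output if it consists
   of the indices of L smallest values of d. *)
Definition ffw_output (R : realType) (N K : nat) (Psi : 'M[R]_(N, K))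
    (L : nat) (A : {set 'I_N}) : Prop :=
  #|A| = L /\
  forall l n : 'I_N, l \in A -> n \notin A -> ffw_d Psi l <= ffw_d Psi n.

(* Main.v *)
Require Import Defs.
From HB Require Import structures.
From mathcomp Require Import all_boot all_order all_algebra.
From mathcomp Require Import ring lra.
From mathcomp Require Import reals.

(** Write [T A] for the Gram matrix of the rows of [Psi] indexed by [A], and
    [<X, Y>] for the Frobenius inner product of matrices.  Three facts turn the
    theorem into convexity in the space of [K x K] matrices:
    - [T] is additive over disjoint sets of rows, and [F A = <T A, T A>];
    - the scores of the algorithm are the gradient of [F] at the full set, up
      to a factor 2: the [d_n] with [n] in [A] add up to [<T A, T setT>];
    - hence [G S = 2 <T S, T setT> - <T S, T S>
                 = <T S, T setT> + <T S, T (~: S)>].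
    Let [S'] and [S*] be the complements of the returned and of the optimal
    set, [D' = <T S', T setT>] and [t = (N - L) / N].  As [S'] collects the
    largest scores, [D'] bounds [\sum_n x n * d_n] for every weight [x] with
    values in [0, 1] and total [N - L] ([sum_weighted_le_top]).  The indicator
    of [S*] gives [<T S*, T setT> <= D'], the constant weight [t] gives
    [t * F setT <= D'].  Expanding [0 <= |T S* - t T setT|^2] then yields
      [G S* <= 2 (1 - t) <T S*, T setT> + t ^ 2 F setT
            <= (1 + L / N) D'],
    while [G S' = D' + <T S', T L'>] ([le_gain_top], [gain_split]).

    The strict inequality comes from the cross term.  When every row has a
    constant sign, Gram matrices have nonnegative entries, and a nonzero one
    has a positive diagonal ([gram_diag_gt0]), so [<T S', T L'> > 0] unless
    [T S'] or [T L'] vanishes.  The first is excluded by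
    [0 < t * F setT <= D'].  If [T L' = 0], then [G S' = F setT] is the largest
    possible gain, and the factor [N / (N + L) < 1] gives strictness.  Here
    [0 < K <= L]: for [K = 0] the columns are vacuously orthonormal. *)

Set Implicit Arguments.
Unset Strict Implicit.
Unset Printing Implicit Defensive.

Import Order.TTheory GRing.Theory Num.Theory.

Local Open Scope ring_scope.

(** * The Frobenius inner product *)

Definition frob (R : realType) (m n : nat) (X Y : 'M[R]_(m, n)) : R :=
  \tr (X^T *m Y).

Lemma frobE (R : realType) (m n : nat) (X Y : 'M[R]_(m, n)) :
  frob X Y = \sum_i \sum_j X i j * Y i j.
Proof.
rewrite /frob /mxtrace exchange_big /=; apply: eq_bigr => j _.
by rewrite mxE; apply: eq_bigr => i _; rewrite mxE.
Qed.

Lemma frobC (R : realType) (m n : nat) (X Y : 'M[R]_(m, n)) :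
  frob X Y = frob Y X.
Proof.
by rewrite !frobE; do 2 (apply: eq_bigr => ? _); rewrite mulrC.
Qed.

Lemma frobDr (R : realType) (m n : nat) (X Y Z : 'M[R]_(m, n)) :
  frob X (Y + Z) = frob X Y + frob X Z.
Proof. by rewrite /frob mulmxDr mxtraceD. Qed.

Lemma frobZr (R : realType) (m n : nat) (a : R) (X Y : 'M[R]_(m, n)) :
  frob X (a *: Y) = a * frob X Y.
Proof. by rewrite /frob -scalemxAr mxtraceZ. Qed.

Lemma frob0r (R : realType) (m n : nat) (X : 'M[R]_(m, n)) : frob X 0 = 0.
Proof. by rewrite /frob mulmx0 mxtrace0. Qed.

Lemma frob_ge0 (R : realType) (m n : nat) (X : 'M[R]_(m, n)) : 0 <= frob X X.
Proof. by rewrite frobE; do 2 (apply: sumr_ge0 => ? _); rewrite -expr2 sqr_ge0. Qed.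

Lemma frob_gt0 (R : realType) (m n : nat) (X Y : 'M[R]_(m, n)) i j :
  (forall a b, 0 <= X a b * Y a b) -> 0 < X i j * Y i j -> 0 < frob X Y.
Proof.
move=> XY0 XYij; rewrite frobE (bigD1 i) //= (bigD1 j) //=.
rewrite -addrA ltr_pwDl // addr_ge0 //; first by apply: sumr_ge0.
by do 2 (apply: sumr_ge0 => ? _).
Qed.

(** The inequality [0 <= |X - t Y|^2], solved for [|X|^2]. *)
Lemma frob_tangent (R : realType) (m n : nat) (t : R) (X Y : 'M[R]_(m, n)) :
  2 * t * frob X Y - t ^+ 2 * frob Y Y <= frob X X.
Proof.
have := frob_ge0 (X + - t *: Y).
rewrite frobDr frobZr ![frob (_ + _) _]frobC !frobDr !frobZr [frob Y X]frobC.
by move=> ?; lra.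
Qed.

(** * Gram matrices of subsets of the rows *)

Definition rows_gram (R : realType) (N K : nat) (Psi : 'M[R]_(N, K))
    (A : {set 'I_N}) : 'M[R]_K :=
  gram (select_rows Psi A).

Lemma rows_gramE (R : realType) (N K : nat) (Psi : 'M[R]_(N, K)) A k l :
  rows_gram Psi A k l = \sum_(n in A) Psi n k * Psi n l.
Proof.
rewrite /rows_gram /gram mxE [RHS]big_enum_val /=.
by apply: eq_bigr => i _; rewrite !mxE.
Qed.

Lemma F_frob (R : realType) (N K : nat) (Psi : 'M[R]_(N, K)) A :
  F Psi A = frob (rows_gram Psi A) (rows_gram Psi A).
Proof. by []. Qed.

Lemma rows_gram_setC (R : realType) (N K : nat) (Psi : 'M[R]_(N, K)) A :
  rows_gram Psi setT = rows_gram Psi A + rows_gram Psi (~: A).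
Proof.
apply/matrixP => k l; rewrite [RHS]mxE !rows_gramE.
rewrite (bigID (mem A)) /=; congr (_ + _).
all: by apply: eq_bigl => n; rewrite !inE.
Qed.

Lemma sum_ffw_d (R : realType) (N K : nat) (Psi : 'M[R]_(N, K))
    (A : {set 'I_N}) :
  \sum_(n in A) ffw_d Psi n = frob (rows_gram Psi A) (rows_gram Psi setT).
Proof.
rewrite frobE /ffw_d exchange_big /=; apply: eq_bigr => k _.
rewrite exchange_big /=; apply: eq_bigr => l _.
rewrite rows_gramE mulr_suml; apply: eq_bigr => n _.
have -> : ffw_m Psi k l = rows_gram Psi setT k l.
  rewrite rows_gramE /ffw_m mxE.
  by apply: eq_big => [i|i _]; rewrite ?inE // !mxE.
by rewrite -mulrA mulrC.
Qed.

Lemma rows_gram_ge0 (R : realType) (N K : nat) (Psi : 'M[R]_(N, K)) A k l :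
  rows_same_sign Psi -> 0 <= rows_gram Psi A k l.
Proof.
move=> sgP; rewrite rows_gramE; apply: sumr_ge0 => n _.
by rewrite -sgr_ge0 sgrM (sgP n k l) -expr2 sqr_ge0.
Qed.

(** A vanishing diagonal entry [\sum_(n in A) Psi n k ^ 2] kills column [k] on
    the rows in [A]; as zeros and nonzeros do not mix within a row, these rows
    are entirely zero. *)
Lemma gram_diag_gt0 (R : realType) (N K : nat) (Psi : 'M[R]_(N, K)) A k :
  rows_same_sign Psi -> rows_gram Psi A != 0 -> 0 < rows_gram Psi A k k.
Proof.
move=> sgP; apply: contraNT; rewrite lt0r (rows_gram_ge0 _ _ _ sgP) andbT negbK.
rewrite rows_gramE psumr_eq0; last by move=> n _; rewrite -expr2 sqr_ge0.
move=> /allP Pk0; apply/eqP/matrixP => i j; rewrite [RHS]mxE rows_gramE.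
apply: big1 => n nA; move: (Pk0 n (mem_index_enum n)).
rewrite nA mulf_eq0 orbb /= -sgr_eq0 (sgP n k i) sgr_eq0 => /eqP ->.
by rewrite mul0r.
Qed.

Lemma rows_gram_setT_neq0 (R : realType) (N K : nat) (Psi : 'M[R]_(N, K)) :
  Psi != 0 -> rows_gram Psi setT != 0.
Proof.
apply: contra => /eqP T0; apply/eqP/matrixP => n k; rewrite mxE.
have /eqP := rows_gramE Psi setT k k; rewrite T0 mxE eq_sym psumr_eq0.
  by move=> /allP /(_ n (mem_index_enum n)); rewrite inE mulf_eq0 orbb => /eqP.
by move=> i _; rewrite -expr2 sqr_ge0.
Qed.

(** * The gain function *)

Lemma gain_split (R : realType) (N K : nat) (Psi : 'M[R]_(N, K)) S :
  G Psi S = frob (rows_gram Psi S) (rows_gram Psi setT)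
            + frob (rows_gram Psi S) (rows_gram Psi (~: S)).
Proof.
rewrite /G !F_frob (rows_gram_setC Psi S) !frobDr ![frob (_ + _) _]frobC !frobDr.
rewrite [frob (rows_gram Psi (~: S)) (rows_gram Psi S)]frobC; ring.
Qed.

(** The tangent bound for [F S] at [t] times the full Gram matrix. *)
Lemma gain_le (R : realType) (N K : nat) (Psi : 'M[R]_(N, K)) S (t : R) :
  G Psi S <= 2 * (1 - t) * frob (rows_gram Psi S) (rows_gram Psi setT)
             + t ^+ 2 * F Psi setT.
Proof.
rewrite gain_split [F _ _]F_frob.
have := frob_tangent t (rows_gram Psi S) (rows_gram Psi setT).
have : frob (rows_gram Psi S) (rows_gram Psi setT)
     = frob (rows_gram Psi S) (rows_gram Psi S)
       + frob (rows_gram Psi S) (rows_gram Psi (~: S)).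
  by rewrite {1}(rows_gram_setC Psi S) frobDr.
by move=> ? ?; lra.
Qed.

(** * Selecting the largest values *)

(** With [c] the least value on [S], each [x n * (d n - c)] is at most
    [d n - c] on [S] and at most 0 off [S]; the multiples of [c] cancel because
    the weight [x] and the indicator of [S] have the same total. *)
Lemma sum_weighted_le_top (R : realType) (I : finType) (d x : I -> R)
    (S : {set I}) :
  (forall l n, l \notin S -> n \in S -> d l <= d n) ->
  (forall n, 0 <= x n <= 1) -> \sum_n x n = #|S|%:R ->
  \sum_n x n * d n <= \sum_(n in S) d n.
Proof.
move=> dS x01 sumx; have [S0|[n0 n0S]] := set_0Vmem S.
  move: sumx; rewrite S0 cards0 big_set0 => /eqP.
  rewrite psumr_eq0; last by move=> n _; case/andP: (x01 n).
  move=> /allP x0; rewrite big1 // => n _.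
  by move/eqP: (x0 n (mem_index_enum n)) => ->; rewrite mul0r.
have [m mS mmin] := arg_minP d n0S.
rewrite -subr_ge0.
have -> : \sum_(n in S) d n - \sum_n x n * d n
        = \sum_n ((n \in S)%:R - x n) * (d n - d m).
  under [RHS]eq_bigr do rewrite mulrBr !mulrBl.
  rewrite !sumrB -!mulr_suml sumx -natr_sum.
  have -> : (\sum_(n : I) (n \in S) = #|S|)%N.
    by rewrite -sum1_card [RHS]big_mkcond /=; apply: eq_bigr => n _; case: (n \in S).
  rewrite subrr subr0; congr (_ - _); rewrite [LHS]big_mkcond /=.
  by apply: eq_bigr => n _; case: (n \in S); rewrite ?mul1r ?mul0r.
apply: sumr_ge0 => n _; have /andP[x0 x1] := x01 n.
case: (boolP (n \in S)) => nS.
  by rewrite mulr_ge0 ?subr_ge0 ?mmin.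
by rewrite sub0r mulNr -mulrN opprB mulr_ge0 ?subr_ge0 ?dS.
Qed.

Section Selection.

Variables (R : realType) (N K L : nat) (Psi : 'M[R]_(N, K)).
Variable A : {set 'I_N}.
Hypotheses (LN : (L < N)%N) (outA : ffw_output Psi L A).

Let top := frob (rows_gram Psi (~: A)) (rows_gram Psi setT).

Lemma card_unselected (B : {set 'I_N}) : #|B| = L -> #|~: B|%:R = N%:R - L%:R :> R.
Proof. by move=> BL; rewrite cardsCs setCK BL card_ord natrB // ltnW. Qed.

Lemma sum_weighted_le_output (x : 'I_N -> R) :
  (forall n, 0 <= x n <= 1) -> \sum_n x n = N%:R - L%:R ->
  \sum_n x n * ffw_d Psi n <= top.
Proof.
case: outA => AL dA x01 sumx; rewrite /top -sum_ffw_d.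
apply: sum_weighted_le_top => //; last by rewrite sumx card_unselected.
by move=> l n; rewrite !inE negbK => lA nA; apply: dA.
Qed.

Lemma score_le_output (B : {set 'I_N}) : #|B| = L ->
  frob (rows_gram Psi (~: B)) (rows_gram Psi setT) <= top.
Proof.
move=> BL; rewrite -sum_ffw_d big_mkcond /=.
rewrite (eq_bigr (fun n => (n \in ~: B)%:R * ffw_d Psi n)); last first.
  by move=> n _; case: (n \in ~: B); rewrite ?mul1r ?mul0r.
apply: sum_weighted_le_output => [n|]; first by case: (n \in ~: B); rewrite lexx ler01.
rewrite -(card_unselected BL) -sum1_card natr_sum [RHS]big_mkcond /=.
by apply: eq_bigr => n _; case: (n \in ~: B).
Qed.

Lemma average_le_output : (N%:R - L%:R) / N%:R * F Psi setT <= top.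
Proof.
have N0 : (0 : R) < N%:R by rewrite ltr0n (leq_ltn_trans _ LN).
have LN' : L%:R < N%:R :> R by rewrite ltr_nat.
rewrite F_frob -sum_ffw_d mulr_sumr (eq_bigl xpredT); last first.
  by move=> n; rewrite inE.
apply: sum_weighted_le_output => [n|].
  rewrite divr_ge0 ?subr_ge0 ?(ltW LN') ?(ltW N0) //=.
  by rewrite ler_pdivrMr // mul1r gerBl.
by rewrite sumr_const card_ord -[_ *+ N]mulr_natr divfK // gt_eqF.
Qed.

(** The tangent bound at the constant weight [t = (N - L) / N] of total
    [N - L]: with [top] bounding both [<T (~: B), T setT>] and [t * F setT], it
    reads [G (~: B) <= (2 (1 - t) + t) top], and [2 - t = (N + L) / N]. *)
Lemma le_gain_top (B : {set 'I_N}) : #|B| = L ->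
  N%:R / (N + L)%:R * G Psi (~: B) <= top.
Proof.
move=> BL.
have N0 : (0 : R) < N%:R by rewrite ltr0n (leq_ltn_trans _ LN).
have L0 : (0 : R) <= L%:R by [].
have LN' : L%:R < N%:R :> R by rewrite ltr_nat.
set t : R := (N%:R - L%:R) / N%:R.
have tN : t * N%:R = N%:R - L%:R by rewrite /t divfK // gt_eqF.
have t0 : 0 <= t by rewrite divr_ge0 ?subr_ge0 ?ltW.
have t1 : 0 <= 1 - t by rewrite -(pmulr_lge0 _ N0) mulrBl tN; lra.
rewrite mulrAC ler_pdivrMr; last by rewrite natrD; lra.
have LNt : L%:R = N%:R * (1 - t) by rewrite mulrBr [_ * t]mulrC tN; ring.
rewrite natrD LNt -{2}[N%:R]mulr1 -mulrDr [top * _]mulrCA ler_pM2l //.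
apply: le_trans (gain_le _ _ t) _.
have h1 := ler_wpM2l t1 (score_le_output BL).
have h2 := ler_wpM2l t0 average_le_output.
rewrite -/t in h2; lra.
Qed.

End Selection.

Lemma gain_le_F (R : realType) (N K : nat) (Psi : 'M[R]_(N, K)) S :
  G Psi S <= F Psi setT.
Proof. by rewrite /G gerBl F_frob frob_ge0. Qed.

Theorem theorem2 (R : realType) (N K L : nat) (Psi : 'M[R]_(N, K))
    (hKN : (K < N)%N) (hrank : \rank Psi = K)
    (hKL : (K <= L)%N) (hLN : (L < N)%N)
    (Lstar : {set 'I_N}) (hopt : optimal_selection Psi L Lstar)
    (hnonorth : ~ orthogonal_columns Psi)
    (hsign : rows_same_sign Psi)
    (L' : {set 'I_N}) (halg : ffw_output Psi L L') :
  G Psi (~: L') > N%:R / (N + L)%:R * G Psi (~: Lstar).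
Proof.
have K0 : (0 < K)%N.
  rewrite lt0n; apply/eqP => K0; apply: hnonorth.
  by apply/matrixP => i; have := ltn_ord i; rewrite {2}K0.
pose k := Ordinal K0.
have Psi0 : Psi != 0 by rewrite -mxrank_eq0 hrank -lt0n.
have TT0 := rows_gram_setT_neq0 Psi0.
have FT0 : 0 < F Psi setT.
  have Tkk := gram_diag_gt0 k hsign TT0.
  rewrite F_frob; apply: (@frob_gt0 _ _ _ _ _ k k) => [a b|].
    by rewrite mulr_ge0 ?rows_gram_ge0.
  by rewrite mulr_gt0.
have [cardLs _] := hopt.
have [TL0|TL0] := eqVneq (rows_gram Psi L') 0.
  have -> : G Psi (~: L') = F Psi setT.
    by rewrite /G setCK [F Psi L']F_frob TL0 frob0r subr0.
  have N0 : (0 : R) < N%:R by rewrite ltr0n (leq_ltn_trans _ hLN).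
  have L0 : (0 : R) < L%:R by rewrite ltr0n (leq_trans K0).
  have NL0 : (0 : R) < (N + L)%:R by rewrite natrD addr_gt0.
  apply: (@le_lt_trans _ _ (N%:R / (N + L)%:R * F Psi setT)).
    by rewrite ler_wpM2l ?gain_le_F // divr_ge0 // ltW.
  by rewrite gtr_pMl // ltr_pdivrMr // mul1r natrD ltrDl.
have TS0 : rows_gram Psi (~: L') != 0.
  apply/eqP => TS0; have := average_le_output hLN halg.
  rewrite TS0 frobC frob0r leNgt mulr_gt0 // divr_gt0 ?subr_gt0 ?ltr_nat //.
  by rewrite ltr0n (leq_ltn_trans _ hLN).
apply: le_lt_trans (le_gain_top hLN halg cardLs) _.
rewrite gain_split setCK ltrDl; apply: (@frob_gt0 _ _ _ _ _ k k) => [a b|].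
  by rewrite mulr_ge0 ?rows_gram_ge0.
by rewrite mulr_gt0 ?gram_diag_gt0.
Qed.
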